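(* Let $k\geq 2$, $\ell_1,\ell_2\geq 2$ and $r\geq \ell_1+\ell_2+k-1$ be integers, let $T$ be a tree with $\ell_1$ edges, and let $\ell_{\max}=\max\{\ell_1,\ell_2\}$, $\ell_{\min}=\min\{\ell_1,\ell_2\}$. Assume that ${\rm ex}_{r-k+1}(m,{\rm Berge}\text{-}T)\leq \frac{m(\ell_1-1)}{r-k+2}$ for every $m$. Then for every $n\geq k-1$, $$ {\rm ex}_r(n,{\rm Berge}\text{-}T\cup (k-1)S_{\ell_2})\geq (\ell_{\min}-1)\left\lfloor\frac{n-k+1}{r-k+2}\right\rfloor, $$ and there is a constant $C$ independent of $n$ such that for all sufficiently large $n$, $$ {\rm ex}_r(n,{\rm Berge}\text{-}T\cup (k-1)S_{\ell_2})\leq \frac{(\ell_{\max}-1)n}{r-k+2}+C. $$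
   Context: For an integer $p\geq 2$, a $p$-graph is a hypergraph whose hyperedges are distinct $p$-element subsets of the vertex set. For a graph $F$, a $p$-graph $H$ is a Berge-$F$ if there is a bijection $\phi:E(F)\to E(H)$ with $e\subseteq\phi(e)$ for each $e\in E(F)$; a $p$-graph contains a Berge-$F$ if some subhypergraph is a Berge-$F$. ${\rm ex}_p(n,{\rm Berge}\text{-}F)$ is the maximum number of hyperedges in an $n$-vertex $p$-graph containing no Berge-$F$. $S_m$ is the star with $m$ edges; $\cup$ is vertex-disjoint union and $cG$ is the disjoint union of $c$ copies of $G$. *)

(* Defs.v *)
From HB Require Import structures.
From mathcomp Require Import all_boot all_order all_algebra.

Set Implicit Arguments.
Unset Strict Implicit.
Unset Printing Implicit Defensive.

Record sgraph (V : finType) := SGraph {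
  adj : rel V;
  adj_sym : symmetric adj;
  adj_irr : irreflexive adj
}.

Definition edges (V : finType) (G : sgraph V) : {set {set V}} :=
  [set e : {set V} | [exists x, exists y, adj G x y && (e == [set x; y])]].

Definition acyclic (V : finType) (G : sgraph V) : Prop :=
  forall c : seq V, 2 < size c -> ~ ucycle (adj G) c.

Definition is_tree (V : finType) (G : sgraph V) : Prop :=
  [/\ 0 < #|V|, (forall x y : V, connect (adj G) x y) & acyclic G].

(* The star with m edges: centre ord0, with the m other vertices as leaves. *)
Section Star.
Variable m : nat.
Definition star_adj : rel 'I_m.+1 :=
  fun x y => (x != y) && ((x == ord0) || (y == ord0)).
Lemma star_adj_sym : symmetric star_adj.
Proof. by move=> x y; rewrite /star_adj eq_sym orbC. Qed.
Lemma star_adj_irr : irreflexive star_adj.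
Proof. by move=> x; rewrite /star_adj eqxx. Qed.
Definition star : sgraph 'I_m.+1 := SGraph star_adj_sym star_adj_irr.
End Star.

Section DisjointUnion.
Variables (V1 V2 : finType) (G1 : sgraph V1) (G2 : sgraph V2).
Definition dunion_adj : rel (V1 + V2)%type := fun x y =>
  match x, y with
  | inl a, inl b => adj G1 a b
  | inr a, inr b => adj G2 a b
  | _, _ => false
  end.
Lemma dunion_adj_sym : symmetric dunion_adj.
Proof. by case=> a [] b //=; apply: adj_sym. Qed.
Lemma dunion_adj_irr : irreflexive dunion_adj.
Proof. by case=> a /=; apply: adj_irr. Qed.
Definition dunion : sgraph (V1 + V2)%type :=
  SGraph dunion_adj_sym dunion_adj_irr.
End DisjointUnion.

Section Copies.
Variables (c : nat) (V : finType) (G : sgraph V).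
Definition copies_adj : rel ('I_c * V)%type :=
  fun x y => (x.1 == y.1) && adj G x.2 y.2.
Lemma copies_adj_sym : symmetric copies_adj.
Proof. by move=> x y; rewrite /copies_adj eq_sym adj_sym. Qed.
Lemma copies_adj_irr : irreflexive copies_adj.
Proof. by move=> x; rewrite /copies_adj adj_irr andbF. Qed.
Definition copies : sgraph ('I_c * V)%type :=
  SGraph copies_adj_sym copies_adj_irr.
End Copies.

(* A hypergraph on V is represented by its set of hyperedges. *)
Definition pgraph (p : nat) (V : finType) (H : {set {set V}}) : bool :=
  [forall h in H, #|h| == p].

(* f identifies the vertices of F with vertices of the hypergraph, and phi
   restricts to a bijection from E(F) onto E(H); the values of phi outside E(F)
   are irrelevant. *)
Definition is_berge (U V : finType) (F : sgraph U) (H : {set {set V}}) : bool :=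
  [exists f : {ffun U -> V}, exists phi : {ffun {set U} -> {set V}},
    [&& injectiveb f,
        dinjectiveb phi (mem (edges F)),
        phi @: edges F == H
      & [forall e in edges F, f @: e \subset phi e]]].

Definition contains_berge (U V : finType) (F : sgraph U) (H : {set {set V}})
  : bool :=
  [exists H' : {set {set V}}, (H' \subset H) && is_berge F H'].

(* The maximum is over a nonempty family as soon as F has an edge, the
   hypergraph without hyperedges being then admissible. *)
Definition ex_berge (p n : nat) (U : finType) (F : sgraph U) : nat :=
  \max_(H : {set {set 'I_n}} | pgraph p H && ~~ contains_berge F H) #|H|.

(* Main.v *)
(** Lower bound: fix a set [K] of [k - 1] vertices, cut the rest into blocks of
    size [r - k + 2], and take in each block [min l1 l2 - 1] hyperedges made of
    [K] and the block minus one vertex. One of the [k] components of the forest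
    avoids [K], hence stays in one block, which has too few hyperedges.

    Upper bound: let [s = r - k + 1] and let [L] be the set of vertices of degree
    at least a large constant.
    - If [L] contains a set [K] of [k - 1] vertices, shrink the hyperedges to
      distinct [s]-sets disjoint from [K]. If this is impossible, or if the
      shrunken hypergraph has a Berge copy of [T], then there is a Berge copy of
      [T] off [K], and stars centred at [K] complete it greedily. Otherwise the
      hypothesis on [T] applies.
    - If [L] has fewer than [k - 1] vertices, pick disjoint Berge stars off [L]
      greedily. When this stops early, double counting bounds the hyperedges by
      [(l2 - 1) n / (s + 1)]. Otherwise delete the boundedly many hyperedges
      that meet the [k - 1] stars and apply the shrinking argument with [L] in
      place of [K]. *)
Require Import Defs.
From HB Require Import structures.
From mathcomp Require Import all_boot all_order all_algebra.
From mathcomp Require Import zify.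
Import Order.TTheory GRing.Theory Num.Theory.

Set Implicit Arguments.
Unset Strict Implicit.
Unset Printing Implicit Defensive.

(** * Unordered pairs and greedy choice in finite sets *)

Lemma set2_eqP (T : finType) (x y x' y' : T) :
  [set x; y] = [set x'; y'] -> (x = x' /\ y = y') \/ (x = y' /\ y = x').
Proof.
move=> E.
have := set21 x y; have := set22 x y; rewrite E !inE.
have := set21 x' y'; have := set22 x' y'; rewrite -E !inE.
by do 4![case/orP=> /eqP ?]; subst; auto.
Qed.

Lemma card_le_injection (T W : finType) (B : {set W}) :
  #|T| <= #|B| -> exists2 f : T -> W, injective f & forall x, f x \in B.
Proof.
move=> le_TB; exists (fun x => enum_val (widen_ord le_TB (enum_rank x))).
  move=> x y /enum_val_inj/(congr1 val) E.
  by apply: enum_rank_inj; apply: val_inj.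
by move=> x; apply: enum_valP.
Qed.

Lemma subset_of_card (W : finType) (B : {set W}) m :
  m <= #|B| -> exists2 A : {set W}, A \subset B & #|A| = m.
Proof.
rewrite -{1}[m]card_ord => /card_le_injection[f f_inj fB].
exists (f @: setT); last by rewrite card_imset // cardsT card_ord.
by apply/subsetP=> _ /imsetP[x _ ->].
Qed.

(** Going through [E] one element at a time, fewer than [#|E|] values are already taken, so each
    [C e] still offers a fresh one. *)
Lemma greedy_sdr (T W : finType) (w0 : W) (E : {set T}) (C : T -> {set W}) :
  (forall e, e \in E -> #|E| <= #|C e|) ->
  exists2 b : T -> W, {in E &, injective b} & forall e, e \in E -> b e \in C e.
Proof.
move=> hC.
suff [b bI bC] : exists2 b : T -> W, {in enum E &, injective b}
    & forall e, e \in enum E -> b e \in C e.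
  exists b => [e e' he he'|e he]; first by apply: bI; rewrite mem_enum.
  by apply: bC; rewrite mem_enum.
have : {subset enum E <= E} by move=> e; rewrite mem_enum.
have : size (enum E) <= #|E| by rewrite -cardE.
have := enum_uniq E; elim: (enum E) => [|e s IHs] /=; first by exists (fun=> w0).
case/andP=> es us ss sE; case: IHs => // [|x xs|b bI bC]; first exact: ltnW.
  by apply: sE; rewrite inE xs orbT.
have /existsP[w /andP[wC wb]] : [exists w, (w \in C e) && (w \notin [seq b x | x <- s])].
  apply: contraT => /existsPn nw.
  have : C e \subset [seq b x | x <- s].
    by apply/subsetP=> w wC; have := nw w; rewrite wC negbK.
  move/subset_leq_card; rewrite leqNgt => /negP[].
  apply: leq_ltn_trans (card_size _) _; rewrite size_map; apply: leq_trans ss _.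
  by apply: hC; apply: sE; rewrite inE eqxx.
exists [eta b with e |-> w] => [x y|x] /=; rewrite !inE.
  case: (x =P e) => [-> _|_ /= xs]; case: (y =P e) => [->//|_ /= ys].
  - by move=> E1; move: wb; rewrite E1 map_f.
  - by move=> _ E1; move: wb; rewrite -E1 map_f.
  exact: bI.
by case: (x =P e) => [->|_] //= /bC.
Qed.

(** * Berge copies with a prescribed place for the core *)

(* [g x y] is the hyperedge assigned to the edge [{x, y}]; its values on
   non-adjacent pairs are irrelevant. *)
Definition berge_emb (U W : finType) (F : sgraph U) (H : {set {set W}})
    (A : {set W}) (f : U -> W) (g : U -> U -> {set W}) : Prop :=
  [/\ injective f, forall x, f x \in A,
      forall x y, adj F x y -> [/\ g x y \in H, f x \in g x y & g y x = g x y]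
    & forall x y x' y', adj F x y -> adj F x' y' -> g x y = g x' y' ->
        [set x; y] = [set x'; y']].

(** Only the core vertices are confined to [A]; the hyperedges may leave it. Copies with disjoint
    cores and disjoint hyperedges can then be put together. *)
Definition berge_in (U W : finType) (F : sgraph U) (H : {set {set W}})
    (A : {set W}) : Prop :=
  exists f : U -> W, exists g : U -> U -> {set W}, berge_emb F H A f g.

Lemma mem_edges (U : finType) (F : sgraph U) x y :
  adj F x y -> [set x; y] \in edges F.
Proof.
move=> xy; rewrite inE; apply/existsP; exists x; apply/existsP; exists y.
by rewrite xy eqxx.
Qed.

Lemma edgesP (U : finType) (F : sgraph U) e :
  reflect (exists x y, adj F x y /\ e = [set x; y]) (e \in edges F).
Proof.
apply: (iffP idP) => [|[x [y [xy ->]]]]; last exact: mem_edges.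
by rewrite inE => /existsP[x /existsP[y /andP[xy /eqP->]]]; exists x, y.
Qed.

(** A symmetric labelling of ordered pairs descends to edges: read it off any orientation that
    [pick] returns. *)
Lemma edge_label (U W : finType) (F : sgraph U) (g : U -> U -> {set W}) :
  (forall x y, adj F x y -> g y x = g x y) ->
  exists phi : {set U} -> {set W}, forall x y, adj F x y -> phi [set x; y] = g x y.
Proof.
move=> gC.
exists (fun e => if [pick p | adj F p.1 p.2 && (e == [set p.1; p.2])] is Some p
                 then g p.1 p.2 else set0) => x y xy.
case: pickP => [[x' y'] /= /andP[xy' /eqP/set2_eqP[[-> ->]|[-> ->]]] //|/(_ (x, y))].
  by rewrite (gC _ _ xy').
by rewrite /= xy eqxx.
Qed.

Lemma contains_bergeP (U W : finType) (F : sgraph U) (H : {set {set W}}) :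
  contains_berge F H <-> berge_in F H setT.
Proof.
split=> [/existsP[H' /andP[sH /existsP[f /existsP[phi /and4P[/injectiveP fI]]]]]|].
  move=> /dinjectiveP phiI /eqP eH /forallP phiS.
  exists f, (fun x y => phi [set x; y]); split=> // [x y xy|x y x' y' xy xy'].
    have xyE := mem_edges xy; split; last by rewrite setUC.
      by apply: (subsetP sH); rewrite -eH imset_f.
    by apply: (subsetP (implyP (phiS _) xyE)); rewrite imset_f // set21.
  by apply: phiI; apply: mem_edges.
case=> f [g [fI _ gP gI]].
have [|phi phiE] := @edge_label _ _ F g; first by move=> x y /gP[].
apply/existsP; exists (phi @: edges F); apply/andP; split.
  apply/subsetP=> _ /imsetP[_ /edgesP[x [y [xy ->]]] ->].
  by rewrite phiE //; case: (gP _ _ xy).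
apply/existsP; exists (finfun f); apply/existsP; exists (finfun phi).
apply/and4P; split.
- by apply/injectiveP=> x y; rewrite !ffunE; apply: fI.
- apply/dinjectiveP=> _ _ /edgesP[x [y [xy ->]]] /edgesP[x' [y' [xy' ->]]].
  by rewrite !ffunE !phiE //; apply: gI.
- by apply/eqP/eq_imset=> e; rewrite ffunE.
apply/forall_inP=> _ /edgesP[x [y [xy ->]]]; rewrite ffunE phiE //.
have [_ fx gC] := gP _ _ xy; have [_ fy _] := gP _ _ (etrans (adj_sym F y x) xy).
by apply/subsetP=> _ /imsetP[z /set2P[]-> ->]; rewrite ffunE // -gC.
Qed.

(** * Restricting, combining and greedily building Berge copies *)

Section BergeIn.
Variable W : finType.
Implicit Types (H E : {set {set W}}) (A K L B : {set W}).

Lemma berge_emb_hom (U U' : finType) (F : sgraph U) (F' : sgraph U') H A A'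
    (i : U' -> U) f g :
  injective i -> (forall x y, adj F' x y -> adj F (i x) (i y)) ->
  (forall x, f (i x) \in A') -> berge_emb F H A f g -> berge_in F' H A'.
Proof.
move=> iI ih fA' [fI fA gP gI].
exists (f \o i), (fun x y => g (i x) (i y)).
split=> [x y /fI/iI //|x|x y xy|x y x' y' xy xy'] //=; first exact/gP/ih.
move/(gI _ _ _ _ (ih _ _ xy) (ih _ _ xy'))/set2_eqP.
by case=> -[/iI-> /iI->] //; rewrite setUC.
Qed.

Lemma berge_in_sub (U : finType) (F : sgraph U) H H' A A' :
  H \subset H' -> A \subset A' -> berge_in F H A -> berge_in F H' A'.
Proof.
move=> /subsetP sH /subsetP sA [f [g [fI fA gP gI]]]; exists f, g; split=> // [x|x y xy].
  exact: sA.
by have [/sH] := gP _ _ xy.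
Qed.

(** Keeping only what the copy uses bounds its size independently of the host, so that little is
    forbidden to later greedy choices. The square counts ordered pairs of vertices. *)
Lemma berge_in_small (U : finType) (F : sgraph U) H A : berge_in F H A ->
  exists E A', [/\ E \subset H, A' \subset A, #|E| <= #|U| ^ 2, #|A'| <= #|U|
    & berge_in F E A'].
Proof.
case=> f [g [fI fA gP gI]].
exists [set g p.1 p.2 | p in [set p | adj F p.1 p.2]], (f @: setT); split.
- by apply/subsetP=> _ /imsetP[[x y] + ->]; rewrite inE /= => /gP[].
- by apply/subsetP=> _ /imsetP[x _ ->].
- by apply: leq_trans (leq_imset_card _ _) _; rewrite (leq_trans (max_card _)) // card_prod mulnn.
- by apply: leq_trans (leq_imset_card _ _) _; rewrite cardsT.
exists f, g; split=> // [x|x y xy]; first exact: imset_f.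
have [_ fx gC] := gP _ _ xy; split=> //.
by apply/imsetP; exists (x, y); rewrite // inE.
Qed.

(** Each hyperedge used contains a core vertex. A second copy made of hyperedges that miss [A] is
    thus automatically edge-disjoint from this one. *)
Lemma berge_in_meet (U : finType) (F : sgraph U) H A : berge_in F H A ->
  berge_in F [set h in H | ~~ [disjoint h & A]] A.
Proof.
case=> f [g [fI fA gP gI]]; exists f, g; split=> // x y xy.
have [gH fx gC] := gP _ _ xy; split=> //; rewrite inE gH.
by apply/pred0Pn; exists (f x); rewrite /= fx fA.
Qed.

Lemma berge_in_dunion (U1 U2 : finType) (F1 : sgraph U1) (F2 : sgraph U2)
    H1 H2 A1 A2 :
  [disjoint H1 & H2] -> [disjoint A1 & A2] ->
  berge_in F1 H1 A1 -> berge_in F2 H2 A2 ->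
  berge_in (dunion F1 F2) (H1 :|: H2) (A1 :|: A2).
Proof.
move=> dH dA [f1 [g1 [f1I f1A g1P g1I]]] [f2 [g2 [f2I f2A g2P g2I]]].
exists (fun x => match x with inl a => f1 a | inr b => f2 b end).
exists (fun x y => match x, y with
  | inl a, inl b => g1 a b | inr a, inr b => g2 a b | _, _ => set0 end).
have fE a b : f1 a <> f2 b.
  by move=> E; have := disjointFr dA (f1A a); rewrite E f2A.
have gE a b c d : adj F1 a b -> adj F2 c d -> g1 a b <> g2 c d.
  move=> ab cd E; have [gH _ _] := g1P _ _ ab; have [gH' _ _] := g2P _ _ cd.
  by have := disjointFr dH gH; rewrite E gH'.
split.
- case=> a [] b; first by move/f1I->.
  + by move/fE.
  + by move/esym/fE.
  by move/f2I->.
- by case=> a; rewrite inE ?f1A ?f2A ?orbT.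
- case=> a [] b //= ab; first by have [? ? ?] := g1P _ _ ab; rewrite inE; split=> //; apply/orP; left.
  by have [? ? ?] := g2P _ _ ab; rewrite inE; split=> //; apply/orP; right.
case=> a [] b // [] c [] d //= ab cd.
- by move/(g1I _ _ _ _ ab cd)/set2_eqP=> [[-> ->]|[-> ->]] //; rewrite setUC.
- by move/(gE _ _ _ _ ab cd).
- by move/esym/(gE _ _ _ _ cd ab).
by move/(g2I _ _ _ _ ab cd)/set2_eqP=> [[-> ->]|[-> ->]] //; rewrite setUC.
Qed.

Lemma berge_in_copies0 (U : finType) (F : sgraph U) H A : berge_in (copies 0 F) H A.
Proof.
have no (p : 'I_0 * U) : False by case: p => -[].
exists (fun p => match no p with end), (fun p _ => match no p with end).
by split=> p; case: (no p).
Qed.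

Lemma berge_in_copiesS (U : finType) (F : sgraph U) c H1 H2 A1 A2 :
  [disjoint H1 & H2] -> [disjoint A1 & A2] ->
  berge_in F H1 A1 -> berge_in (copies c F) H2 A2 ->
  berge_in (copies c.+1 F) (H1 :|: H2) (A1 :|: A2).
Proof.
move=> dH dA b1 b2.
pose i (p : 'I_c.+1 * U) : U + 'I_c * U :=
  if unlift ord_max p.1 is Some j then inr (j, p.2) else inl p.2.
have [f [g fg]] := berge_in_dunion dH dA b1 b2.
apply: (berge_emb_hom (i := i) _ _ _ fg); last by move=> x; case: fg.
  move=> [j a] [j' b]; rewrite /i /=.
  case: unliftP => [i'|] ->; case: unliftP => [j''|] -> // [].
    by move=> -> ->.
  by move=> ->.
move=> [j a] [j' b] /= /andP[/= /eqP-> ab]; rewrite /i /=.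
by case: unliftP => [j''|] _ //=; rewrite /copies_adj /= eqxx.
Qed.

(** The leaves are added one by one: [X] holds the centre and the earlier leaves, [Y] the hyperedges
    already spent. *)
Lemma star_greedy l H v A : v \notin A ->
  (forall (X : {set W}) (Y : {set {set W}}), #|X| <= l -> #|Y| < l ->
     exists h u, [/\ h \in H, h \notin Y, v \in h, u \in h & u \notin X :|: A]) ->
  berge_in (star l) H (~: A).
Proof.
move=> vA step.
suff [us [hs [usP usI hsI]]] : exists (us : nat -> W) (hs : nat -> {set W}),
  [/\ forall i, i < l ->
        [/\ hs i \in H, v \in hs i, us i \in hs i, us i \notin A & us i != v],
      forall i j, i < l -> j < l -> us i = us j -> i = j
    & forall i j, i < l -> j < l -> hs i = hs j -> i = j].
  (* Leaves are numbered from 0, whereas vertex 0 of the star is its centre; hence the shift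
     [x.-1]. *)
  exists (fun x : 'I_l.+1 => if x == ord0 then v else us x.-1).
  exists (fun x y : 'I_l.+1 => if x == ord0 then hs y.-1 else hs x.-1).
  have bd (x : 'I_l.+1) : x != ord0 -> x.-1 < l /\ x = x.-1.+1 :> nat.
    by case: x => -[|x] //= hx _.
  split.
  - move=> x y; case: (x =P ord0) => [->|/eqP/bd[xl xE]];
      case: (y =P ord0) => [->|/eqP/bd[yl yE]] //.
    + by move=> E; have [_ _ _ _] := usP _ yl; rewrite -E eqxx.
    + by move=> E; have [_ _ _ _] := usP _ xl; rewrite E eqxx.
    by move/(usI _ _ xl yl)=> E; apply: val_inj; rewrite /= xE yE E.
  - move=> x; rewrite inE; case: (x =P ord0) => [//|/eqP/bd[xl _]].
    by have [] := usP _ xl.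
  - move=> x y /andP[xy /orP[]/eqP E]; subst.
      have y0 : y != ord0 by rewrite eq_sym.
      by rewrite eqxx (negPf y0); have [yl _] := bd _ y0; have [] := usP _ yl.
    by rewrite eqxx (negPf xy); have [xl _] := bd _ xy; have [] := usP _ xl.
  have main (x y : 'I_l.+1) : star_adj x y -> exists z : 'I_l.+1,
     [/\ z != ord0, [set x; y] = [set ord0; z]
       & (if x == ord0 then hs y.-1 else hs x.-1) = hs z.-1].
    move=> /andP[xy /orP[]/eqP E]; subst.
      by exists y; rewrite eq_sym eqxx.
    by exists x; rewrite (negPf xy) setUC.
  move=> x y x' y' /main[z [z0 -> ->]] /main[z' [z0' -> ->]].
  have [zl zE] := bd _ z0; have [zl' zE'] := bd _ z0'.
  by move/(hsI _ _ zl zl')=> E; congr [set _; _]; apply: val_inj; rewrite /= zE zE' E.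
suff: forall m, m <= l -> exists (us : nat -> W) (hs : nat -> {set W}),
  [/\ forall i, i < m ->
        [/\ hs i \in H, v \in hs i, us i \in hs i, us i \notin A & us i != v],
      forall i j, i < m -> j < m -> us i = us j -> i = j
    & forall i j, i < m -> j < m -> hs i = hs j -> i = j] by apply.
elim=> [|m IHm] ml; first by exists (fun=> v), (fun=> set0).
have [us [hs [usP usI hsI]]] := IHm (ltnW ml).
have [||h [u [hH hY vh uh]]] :=
    step (v |: [set us i | i : 'I_m]) [set hs i | i : 'I_m].
- apply: leq_trans (leq_card_setU _ _) _; rewrite cards1 add1n.
  by apply: leq_trans ml; rewrite ltnS; apply: leq_trans (leq_imset_card _ _) _; rewrite card_ord.
- by apply: leq_ltn_trans (leq_imset_card _ _) _; rewrite card_ord.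
rewrite !inE !negb_or => /andP[/andP[uv uX] uA].
have uN i : i < m -> us i <> u.
  by move=> im E; case/imsetP: uX; exists (Ordinal im).
have hN i : i < m -> hs i <> h.
  by move=> im E; case/imsetP: hY; exists (Ordinal im).
exists (fun i => if i == m then u else us i), (fun i => if i == m then h else hs i).
have lt i : i < m.+1 -> i <> m -> i < m by lia.
split=> [i im|i j im jm|i j im jm].
- by case: (i =P m) => [_ //|/(lt _ im)]; apply: usP.
- case: (i =P m) => [->|/(lt _ im) im']; case: (j =P m) => [->|/(lt _ jm) jm'] //.
  + by move/esym/(uN _ jm').
  + by move/(uN _ im').
  exact: usI.
case: (i =P m) => [->|/(lt _ im) im']; case: (j =P m) => [->|/(lt _ jm) jm'] //.
- by move/esym/(hN _ jm').
- by move/(hN _ im').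
exact: hsI.
Qed.

End BergeIn.

(** * Vertex degrees and disjoint Berge stars *)

Section Stars.
Variable W : finType.
Implicit Types (H E : {set {set W}}) (A K L B : {set W}).

Definition hdeg H x := #|[set h in H | x \in h]|.

(** Count the incidences between hyperedges and vertices off [L] in two ways. *)
Lemma hdeg_double_count H L q d :
  (forall h, h \in H -> q <= #|h :\: L|) ->
  (forall x, x \notin L -> hdeg H x <= d) -> #|H| * q <= d * #|W|.
Proof.
move=> hq hd.
have -> : #|H| * q = \sum_(h in H) q by rewrite sum_nat_const.
apply: (@leq_trans (\sum_(h in H) #|h :\: L|)); first exact: leq_sum.
have -> : \sum_(h in H) #|h :\: L| = \sum_(x in ~: L) hdeg H x.
  under eq_bigr => h _ do rewrite -sum1_card.
  rewrite (exchange_big_dep (mem (~: L))) /=; last first.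
    by move=> h x _; rewrite !inE => /andP[].
  apply: eq_bigr => x xL; rewrite /hdeg -sum1_card.
  by apply: eq_bigl => h; rewrite !inE; move: xL; rewrite inE => ->.
apply: leq_trans (_ : \sum_(x in ~: L) d <= _).
  by apply: leq_sum => x; rewrite inE; apply: hd.
by rewrite sum_nat_const mulnC leq_mul2l max_card orbT.
Qed.

Lemma card_meet H A D : (forall x, x \in A -> hdeg H x <= D) ->
  #|[set h in H | ~~ [disjoint h & A]]| <= #|A| * D.
Proof.
move=> hD; rewrite -sum_nat_const.
apply: (@leq_trans (\sum_(x in A) hdeg H x)); last exact: leq_sum.
apply: (@leq_trans #|\bigcup_(x in A) [set h in H | x \in h]|).
  apply/subset_leq_card/subsetP=> h; rewrite inE => /andP[hH /pred0Pn[x /= /andP[xh xA]]].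
  by apply/bigcupP; exists x; rewrite // inE hH.
elim/big_ind2: _ => [|m1 B1 m2 B2 h1 h2|//]; first by rewrite cards0.
by apply: leq_trans (leq_card_setU _ _) _; apply: leq_add.
Qed.

Lemma card_filter_disjoint H A :
  #|H| = #|[set h in H | [disjoint h & A]]| + #|[set h in H | ~~ [disjoint h & A]]|.
Proof.
rewrite -(cardsID [set h : {set W} | [disjoint h & A]] H).
by congr (_ + _); apply: eq_card => h; rewrite !inE // andbC.
Qed.

(** Induction on [j], where [A] is the core of the stars found so far. A vertex off [L] in at least
    [l] hyperedges missing [A] gives one more star. Without such a vertex, double counting bounds
    the hyperedges missing [A], and at most [#|A| * D] others meet it. *)
Lemma low_degree_stars H L q l D : 0 < l -> l < q ->
  (forall h, h \in H -> q <= #|h :\: L|) ->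
  (forall x, x \notin L -> hdeg H x <= D) ->
  forall j, #|H| * q <= (l - 1) * #|W| + j * l.+1 * D * q \/
  exists A, [/\ A \subset ~: L, #|A| <= j * l.+1 & berge_in (copies j (star l)) H A].
Proof.
move=> l0 lq hq hD; elim=> [|j [IHj|[A [AL Aj bA]]]].
- by right; exists set0; rewrite sub0set cards0; split=> //; apply: berge_in_copies0.
- by left; apply: leq_trans IHj _; rewrite leq_add2l !leq_mul2r leqnSn !orbT.
pose H1 := [set h in H | [disjoint h & A]].
have [/existsP[v /andP[vL vl]]|/existsPn nv] :=
    boolP [exists v, (v \notin L) && (l <= hdeg H1 v)].
  right.
  have vA : v \notin A.
    have : 0 < hdeg H1 v by apply: leq_trans vl.
    case/card_gt0P=> h; rewrite !inE => /andP[/andP[_ hA] vh].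
    by rewrite (disjointFr hA vh).
  have bS : berge_in (star l) H1 (~: (L :|: A)).
    apply: (@star_greedy _ _ _ v) => [|X Y Xl Yl]; first by rewrite inE negb_or vL.
    have /subsetPn[h] : ~~ ([set h in H1 | v \in h] \subset Y).
      by apply/negP=> /subset_leq_card; rewrite leqNgt (leq_trans Yl).
    rewrite inE => /andP[hH1 vh] hY.
    (* [h] has at least [q > l] vertices off [L], and [X] at most [l]; missing [A] comes for free,
       since [h] does. *)
    have /subsetPn[u] : ~~ (h :\: L \subset X).
      apply/negP=> /subset_leq_card; have := hq h; move: hH1; rewrite inE => /andP[-> _] /(_ isT).
      by move: Xl lq; lia.
    rewrite inE => /andP[uL uh] uX; exists h, u; split=> //.
    move: hH1; rewrite !inE => /andP[_ dh].
    by rewrite (negPf uX) (negPf uL) (disjointFr dh uh).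
  have [E [A' [EH1 sA' _ cA' bA']]] := berge_in_small bS.
  rewrite card_ord in cA'.
  have dA : [disjoint A' & A].
    by apply/pred0P=> x /=; apply/andP=> -[/(subsetP sA')]; rewrite !inE negb_or => /andP[_ /negPf->].
  have dE : [disjoint E & [set h in H | ~~ [disjoint h & A]]].
    apply/pred0P=> h /=; apply/andP=> -[/(subsetP EH1)]; rewrite !inE => /andP[_ ->].
    by rewrite andbF.
  exists (A' :|: A); split.
  - rewrite subUset AL andbT; apply/subsetP=> x /(subsetP sA').
    by rewrite !inE negb_or => /andP[].
  - by apply: leq_trans (leq_card_setU _ _) _; rewrite mulSn leq_add.
  apply: berge_in_sub (berge_in_copiesS dE dA bA' (berge_in_meet bA)) => //.
  apply/subsetP=> h; rewrite inE => /orP[/(subsetP EH1)|]; rewrite inE => /andP[] //.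
left.
have h1 : #|H1| * q <= (l - 1) * #|W|.
  apply: (hdeg_double_count (L := L)) => [h|x xL]; first by rewrite inE => /andP[/hq].
  by have := nv x; rewrite xL /= -ltnNge; move: l0; lia.
have h2 : #|[set h in H | ~~ [disjoint h & A]]| <= #|A| * D.
  by apply: card_meet => x /(subsetP AL); rewrite inE; apply: hD.
rewrite (card_filter_disjoint H A) mulnDl leq_add // leq_mul2r (leq_trans h2) ?orbT //.
by rewrite leq_mul2r (leq_trans Aj) ?orbT // leq_mul2r leqnSn orbT.
Qed.

(** One star is centred at each vertex of [K]. The degree [D] exceeds the number of hyperedges that
    are excluded, already used, or contained in the set of forbidden vertices; the power of 2 counts
    the last kind. *)
Lemma high_degree_stars H K E0 A0 l D :
  (forall v, v \in K -> D <= hdeg H v) -> [disjoint K & A0] ->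
  #|E0| + (#|K| * l.+1) ^ 2 + l + 2 ^ (#|A0| + #|K| * l.+1 + #|K| + l) <= D ->
  berge_in (copies #|K| (star l)) (H :\: E0) (~: A0).
Proof.
move=> hD dK bD.
(* The stars built so far must also avoid the vertices of [K] outside [s], which are reserved as
   later centres. *)
suff main s : uniq s -> {subset s <= K} ->
    berge_in (copies (size s) (star l)) (H :\: E0) (~: (A0 :|: (K :\: [set x in s]))).
  have := main (enum K) (enum_uniq _); rewrite -cardE.
  case=> [x|f [g [fI fA gP gI]]]; first by rewrite mem_enum.
  by exists f, g; split=> // x; have := fA x; rewrite !inE negb_or => /andP[].
elim: s => [|v s IHs] /=; first by move=> _ _; apply: berge_in_copies0.
case/andP=> vs us sK.
have vK : v \in K by apply: sK; rewrite inE eqxx.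
have sK' : {subset s <= K} by move=> x xs; apply: sK; rewrite inE xs orbT.
have ss : size s <= #|K| by rewrite -(card_uniqP us); apply/subset_leq_card/subsetP.
have [E [A [EH sA cE cA bA]]] := berge_in_small (IHs us sK').
rewrite card_prod !card_ord in cE cA.
have vA : v \notin A.
  by apply/negP=> /(subsetP sA); rewrite !inE vK vs orbT.
pose A1 := A0 :|: A :|: (K :\ v).
have vA1 : v \notin A1.
  by rewrite !inE eqxx /= orbF negb_or vA andbT (disjointFr dK vK).
have bS : berge_in (star l) (H :\: (E0 :|: E)) (~: A1).
  apply: (@star_greedy _ _ _ v) => // X Y Xl Yl.
  have /subsetPn[h] : ~~ ([set h in H | v \in h]
      \subset E0 :|: E :|: Y :|: powerset (X :|: A1)).
    apply/negP=> /subset_leq_card; apply/negP; rewrite -ltnNge.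
    apply: leq_trans (hD v vK); apply: leq_trans bD.
    have sK1 : size s * l.+1 <= #|K| * l.+1 by rewrite leq_mul2r ss orbT.
    have c1 : #|E| <= (#|K| * l.+1) ^ 2 by apply: leq_trans cE _; rewrite leq_exp2r.
    have c2 : #|powerset (X :|: A1)| <= 2 ^ (#|A0| + #|K| * l.+1 + #|K| + l).
      rewrite card_powerset leq_exp2l //; apply: leq_trans (leq_card_setU _ _) _.
      rewrite addnC leq_add //; apply: leq_trans (leq_card_setU _ _) _.
      rewrite leq_add //; last exact/subset_leq_card/subsetDl.
      apply: leq_trans (leq_card_setU _ _) _.
      by rewrite leq_add //; apply: leq_trans cA sK1.
    apply: leq_ltn_trans (leq_card_setU _ _) _; rewrite -addSn leq_add //.
    apply: leq_ltn_trans (leq_card_setU _ _) _; rewrite -addnS leq_add //.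
    by apply: leq_trans (leq_card_setU _ _) _; rewrite leq_add.
  rewrite !inE !negb_or => /andP[hH vh] /andP[/andP[/andP[hE0 hE] hY]].
  by case/subsetPn=> u uh uX; exists h, u; split=> //; rewrite !inE hH negb_or hE0 hE.
have [E' [A' [EH' sA' _ _ bA']]] := berge_in_small bS.
have dA : [disjoint A' & A].
  apply/pred0P=> x /=; apply/andP=> -[/(subsetP sA')]; rewrite !inE !negb_or.
  by case/andP=> /andP[_ /negPf->].
have dE : [disjoint E' & E].
  apply/pred0P=> h /=; apply/andP=> -[/(subsetP EH')]; rewrite !inE !negb_or.
  by case/andP=> /andP[_ /negPf->].
apply: berge_in_sub (berge_in_copiesS dE dA bA' bA) => //.
  rewrite subUset EH andbT; apply/subsetP=> h /(subsetP EH').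
  by rewrite !inE negb_or => /andP[/andP[-> _] ->].
rewrite subUset; apply/andP; split; apply/subsetP=> x.
  move/(subsetP sA'); rewrite !inE.
  by case: (x \in A0) (x \in A) (x == v) (x \in K) => [] [] [] [] //=; rewrite andbF.
move/(subsetP sA); rewrite !inE.
by case: (x \in A0) (x \in s) (x == v) (x \in K) => [] [] [] [].
Qed.

End Stars.

(** * Shrinking hyperedges against a connected graph *)

Section ConnectedGraph.
Variables (V : finType) (T : sgraph V).
Hypothesis Tconn : forall x y : V, connect (adj T) x y.

Lemma connected_neighbor : 0 < #|edges T| -> forall x, exists y, adj T x y.
Proof.
case/card_gt0P=> e /edgesP[a [b [ab _]]] x.
have [->|ax] := eqVneq x a; first by exists b.
have /connectP[[|y p] /= pP E] := Tconn x a; first by rewrite E eqxx in ax.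
by exists y; case/andP: pP.
Qed.

(** Send each vertex other than a root to the edge towards a neighbour closer to the root. The
    farther end of the edge recovers the vertex, so this is injective. *)
Lemma connected_card : #|V| <= #|edges T|.+1.
Proof.
have [->//|/card_gt0P[v0 _]] := posnP #|V|.
(* Tuples make the existence of a walk of length [n] decidable, as [ex_minn] requires. *)
have dist x : exists n, [exists p : n.-tuple V, path (adj T) v0 p && (last v0 p == x)].
  have /connectP[p pP E] := Tconn v0 x.
  by exists (size p); apply/existsP; exists (in_tuple p); rewrite pP -E eqxx.
pose d x := ex_minn (dist x).
have par x : x != v0 -> exists y, adj T x y && (d y < d x).
  move=> xv; rewrite {2}/d; case: ex_minnP => n /existsP[[p /= /eqP pn] /andP[pP /eqP pl]] _.
  case/lastP: p => [|p z] in pn pP pl *; first by rewrite -pl eqxx in xv.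
  rewrite last_rcons in pl; rewrite pl rcons_path in pP.
  case/andP: pP => pP plx; exists (last v0 p); rewrite adj_sym plx /= /d.
  case: ex_minnP => m _; rewrite size_rcons in pn; rewrite -pn ltnS; apply.
  by apply/existsP; exists (in_tuple p); rewrite pP eqxx.
pose p x := odflt v0 [pick y | adj T x y && (d y < d x)].
have pP x : x != v0 -> adj T x (p x) /\ d (p x) < d x.
  move=> /par[y hy]; rewrite /p; case: pickP => [z /andP[]|/(_ y)] //.
  by rewrite hy.
have := cardsC1 v0; have : #|[set~ v0]| <= #|edges T|; last by lia.
rewrite -(card_in_imset (f := fun x => [set x; p x])).
  apply/subset_leq_card/subsetP=> _ /imsetP[x + ->]; rewrite !inE => /pP[xp _].
  by have := mem_edges xp; rewrite inE.
move=> x y; rewrite !inE => /pP[_ dx] /pP[_ dy] /set2_eqP[[]//|[xE yE]].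
by move: dx dy; rewrite yE -xE; lia.
Qed.

(** The hyperedges with exactly [s] vertices off [K] have a forced image and are treated first. Any
    other one contains a set [B] of [s + 1] vertices off [K], and is sent to some [B :\ b] not yet
    taken; if all are taken, [B] hosts the core of a copy of [T]. *)
Lemma shrink_or_berge (W : finType) (H : {set {set W}}) (K : {set W}) s :
  #|V| <= s.+1 -> #|edges T| < s ->
  (forall h, h \in H -> s <= #|h :\: K|) ->
  {in H &, forall h h', #|h :\: K| = s -> h :\: K = h' :\: K -> h = h'} ->
  (exists2 t : {set W} -> {set W}, {in H &, injective t}
     & forall h, h \in H -> t h \subset h :\: K /\ #|t h| = s) \/
  berge_in T H (cover H :\: K).
Proof.
move=> Vs Es hs hd.
pose H0 := [set h in H | #|h :\: K| == s].
suff main (S : seq {set W}) : {subset S <= H} ->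
    (exists2 t : {set W} -> {set W}, {in H0 :|: [set h in S] &, injective t}
     & forall h, h \in H0 :|: [set h in S] -> t h \subset h :\: K /\ #|t h| = s) \/
    berge_in T H (cover H :\: K).
  have HE : H0 :|: [set h in enum H] = H.
    by apply/setP=> h; rewrite !inE mem_enum; case: (h \in H); rewrite //= orbT.
  by have := main (enum H); rewrite HE; apply=> h; rewrite mem_enum.
elim: S => [|h S IHS] SH.
  left; exists (fun h => h :\: K) => [h h'|h]; rewrite !inE !orbF.
    by move=> /andP[hH /eqP c] /andP[hH' _]; apply: hd.
  by move=> /andP[hH /eqP c].
case: IHS => [h' hS|[t tI tP]|]; [by apply: SH; rewrite inE hS orbT| |by right].
have hH : h \in H by apply: SH; rewrite inE eqxx.
have SH' h' : h' \in H0 :|: [set h in S] -> h' \in H.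
  by rewrite !inE => /orP[/andP[]//|hS]; apply: SH; rewrite inE hS orbT.
set H1 := H0 :|: _ in tI tP SH'.
have HSE h' : (h' \in H0 :|: [set h0 in h :: S]) = (h' == h) || (h' \in H1).
  by rewrite !inE orbCA.
have [hH1|hH1] := boolP (h \in H1).
  have HSE' h' : h' \in H0 :|: [set h0 in h :: S] -> h' \in H1.
    by rewrite HSE => /orP[/eqP->|].
  left; exists t => [h1 h2 /HSE' ? /HSE' ?|h1 /HSE']; [exact: tI|exact: tP].
have hs1 : s.+1 <= #|h :\: K|.
  rewrite ltn_neqAle hs // andbT; apply: contra hH1 => /eqP E.
  by rewrite !inE hH -E eqxx.
have [B BhK cB] := subset_of_card hs1.
have [/existsP[b /andP[bB bt]]|/existsPn full] :=
    boolP [exists b, (b \in B) && (B :\ b \notin t @: H1)].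
  left; exists [eta t with h |-> B :\ b] => [h1 h2|h1]; rewrite !HSE /=.
    case: (h1 =P h) => [-> _|_ /= h1H]; case: (h2 =P h) => [->//|_ /= h2H].
    - by move=> E; move: bt; rewrite E imset_f.
    - by move=> _ E; move: bt; rewrite -E imset_f.
    exact: tI.
  case: (h1 =P h) => [->_|_ /=]; last exact: tP.
  rewrite (subset_trans _ BhK) ?subsetDl //; split=> //.
  by move: cB; rewrite (cardsD1 b) bB; lia.
(* Every [B :\ b] is taken, so any injection of the vertices of [T] into [B]
   works: give each edge the hyperedge over [B :\ b] with [b] off that edge. *)
right.
pose u b := odflt set0 [pick h' in H1 | t h' == B :\ b].
have uP b : b \in B -> u b \in H1 /\ t (u b) = B :\ b.
  move=> bB; have := full b; rewrite bB /= negbK => /imsetP[h' h'H E].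
  rewrite /u; case: pickP => [h2 /andP[? /eqP]//|/(_ h')].
  by rewrite h'H -E eqxx.
have [f fI fB] : exists2 f : V -> W, injective f & forall x, f x \in B.
  by apply: card_le_injection; rewrite cB.
have [w0 _] : exists w0, w0 \in B by apply/card_gt0P; rewrite cB.
have [|b bI bB] := @greedy_sdr _ _ w0 (edges T) (fun e => B :\: f @: e).
  move=> _ /edgesP[x [y [_ ->]]].
  (* An edge rules out at most two of the [s + 1] vertices of [B], leaving [s - 1 >= #|edges T|]
     choices for [b]. *)
  have c2 : #|f @: [set x; y]| <= 2.
    by apply: leq_trans (leq_imset_card _ _) _; rewrite cards2; case: eqP.
  have := cardsID (f @: [set x; y]) B.
  have := subset_leq_card (subsetIr B (f @: [set x; y])).
  by move: cB c2 Es; lia.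
have fu x y : adj T x y -> f x \in u (b [set x; y]) :\: K.
  move=> xy; have := bB _ (mem_edges xy); rewrite inE => /andP[nb bBe].
  have [uH uE] := uP _ bBe; have [st _] := tP _ uH.
  apply: (subsetP st); rewrite uE !inE fB andbT.
  by apply: contraNneq nb => <-; rewrite imset_f // set21.
have uH x y : adj T x y -> u (b [set x; y]) \in H1.
  move=> xy; have := bB _ (mem_edges xy); rewrite inE => /andP[_ bBe].
  by have [] := uP _ bBe.
exists f, (fun x y => u (b [set x; y])); split=> // [x|x y xy|x y x' y' xy xy' E].
- have := subsetP BhK _ (fB x); rewrite !inE => /andP[-> xh] /=.
  by apply/bigcupP; exists h.
- split; [exact/SH'/uH| by have := fu _ _ xy; rewrite inE => /andP[]|by rewrite setUC].
(* A common hyperedge gives [B :\ b = B :\ b'], so the omitted vertices agree, and with them the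
   edges. *)
have := bB _ (mem_edges xy); rewrite inE => /andP[_ bBe].
have := bB _ (mem_edges xy'); rewrite inE => /andP[_ bBe'].
apply: bI; rewrite ?mem_edges //.
have [_ E1] := uP _ bBe; have [_ E2] := uP _ bBe'; move: E2; rewrite -E E1 => E2.
by apply/eqP/negPn/negP=> ne; move/setP/(_ (b [set x; y])): E2; rewrite !inE eqxx bBe ne.
Qed.

(** A copy of [T] in the shrunken hypergraph lifts along the injection [t], its core staying off
    [K]; without one, the extremal number for [T] applies. *)
Lemma tree_bound n (H : {set {set 'I_n}}) (K : {set 'I_n}) s :
  0 < #|edges T| ->
  #|V| <= s.+1 -> #|edges T| < s ->
  (forall h, h \in H -> s <= #|h :\: K|) ->
  {in H &, forall h h', #|h :\: K| = s -> h :\: K = h' :\: K -> h = h'} ->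
  #|H| <= ex_berge s n T \/ berge_in T H (cover H :\: K).
Proof.
move=> E0 Vs Es hs hd.
have [[t tI tP]|] := shrink_or_berge Vs Es hs hd; last by right.
have [cb|ncb] := boolP (contains_berge T (t @: H)).
  right; have /contains_bergeP[f [g [fI _ gP gI]]] := cb.
  pose u S := odflt set0 [pick h in H | t h == S].
  have uP x y : adj T x y -> u (g x y) \in H /\ t (u (g x y)) = g x y.
    move=> /gP[/imsetP[h hH E] _ _]; rewrite /u.
    case: pickP => [h2 /andP[? /eqP]//|/(_ h)].
    by rewrite hH -E eqxx.
  have fu x y : adj T x y -> f x \in u (g x y) :\: K.
    move=> xy; have [uH uE] := uP _ _ xy; have [st _] := tP _ uH.
    by apply: (subsetP st); rewrite uE; have [] := gP _ _ xy.
  exists f, (fun x y => u (g x y)); split=> // [x|x y xy|x y x' y' xy xy' E].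
  (* Every vertex of [T] lies on an edge, so its image is covered by a hyperedge. *)
  - have [y xy] := connected_neighbor E0 x; have := fu _ _ xy.
    rewrite !inE => /andP[-> xu] /=; apply/bigcupP; exists (u (g x y)) => //.
    by have [] := uP _ _ xy.
  - have [uH _] := uP _ _ xy; split=> //.
      by have := fu _ _ xy; rewrite inE => /andP[].
    by have [_ _ ->] := gP _ _ xy.
  apply: gI => //; have [_ <-] := uP _ _ xy; have [_ <-] := uP _ _ xy'.
  by rewrite E.
left; rewrite -(card_in_imset tI) /ex_berge.
rewrite (bigD1 (t @: H)) /= ?leq_maxl // ncb andbT.
by apply/forall_inP=> _ /imsetP[h /tP[_ c] ->]; rewrite c.
Qed.

End ConnectedGraph.

(** * The upper bound *)

(** The degree demanded by [high_degree_stars] for [c] centres when a small copy of a graph on [v]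
    vertices is to be avoided. *)
Definition degree_threshold v c l :=
  v ^ 2 + (c * l.+1) ^ 2 + l + 2 ^ (v + c * l.+1 + c + l).

Lemma berge_free_bound (V : finType) (T : sgraph V) c l s n (H : {set {set 'I_n}}) :
  (forall x y : V, connect (adj T) x y) ->
  0 < l -> l <= s -> 0 < #|edges T| < s ->
  pgraph (s + c) H -> ~~ contains_berge (dunion T (copies c (star l))) H ->
  let D := degree_threshold #|V| c l in
  #|H| <= ex_berge s n T + c * l.+1 * D \/
  #|H| * s.+1 <= (l - 1) * n + c * l.+1 * D * s.+1.
Proof.
move=> Tc l0 ls /andP[E0 Es] /forall_inP Hr nb D.
have Vs : #|V| <= s.+1 by apply: leq_trans (connected_card Tc) _; apply: leqW.
have noF (H1 H2 : {set {set 'I_n}}) (A1 A2 : {set 'I_n}) :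
    [disjoint H1 & H2] -> [disjoint A1 & A2] ->
    H1 \subset H -> H2 \subset H ->
    berge_in T H1 A1 -> berge_in (copies c (star l)) H2 A2 -> False.
  move=> dH dA s1 s2 b1 b2; case/negP: nb; apply/contains_bergeP.
  by apply: berge_in_sub (berge_in_dunion dH dA b1 b2) => //; rewrite subUset s1.
pose L := [set x | D <= hdeg H x].
have [cL|Lc] := leqP c #|L|.
  have [K KL cK] := subset_of_card cL.
  have cD h : h \in H -> #|h :&: K| + #|h :\: K| = s + c /\ #|h :&: K| <= c.
    move=> /Hr/eqP <-; rewrite cardsID -cK; split=> //.
    exact/subset_leq_card/subsetIr.
  case: (@tree_bound _ _ Tc n H K s) => //.
  - by move=> h /cD[]; lia.
  (* A hyperedge has [s + c] vertices, so having only [s] off [K] means containing [K]; it is then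
     determined by its trace off [K]. *)
  - have Kh h : h \in H -> #|h :\: K| = s -> h = K :|: (h :\: K).
      move=> /cD[c1 _] c2; have /eqP hK : h :&: K == K.
        by rewrite eqEcard subsetIr cK; lia.
      by rewrite -[LHS](setID h K) hK.
    move=> h h' hH hH' c1 E; rewrite (Kh _ hH c1) E [RHS](Kh _ hH') //.
    by rewrite -E.
  - by move=> le; left; apply: leq_trans le (leq_addr _ _).
  move=> bT; exfalso.
  have [E1 [A1 [EH sA cE cA bA]]] := berge_in_small bT.
  have dK : [disjoint K & A1].
    by apply/pred0P=> x /=; apply/andP=> -[xK /(subsetP sA)]; rewrite inE xK.
  have bS : berge_in (copies c (star l)) (H :\: E1) (~: A1).
    have : berge_in (copies #|K| (star l)) (H :\: E1) (~: A1); last by rewrite cK.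
    apply: (high_degree_stars (D := D)) => //.
      by move=> v /(subsetP KL); rewrite inE.
    by rewrite cK /D /degree_threshold !leq_add // leq_exp2l // !leq_add.
  apply: (noF _ _ _ _ _ _ _ _ bA bS) => //; last exact: subsetDl.
    by rewrite disjoint_sym; apply/pred0P=> x /=; rewrite inE andbC andbA andbN.
  by apply/pred0P=> x /=; rewrite inE andbN.
have LP x : x \notin L -> hdeg H x <= D by rewrite inE -ltnNge => /ltnW.
(* As [#|L| < c], one vertex is gained. This gives the divisor [s + 1] in the double counting, and
   leaves no hyperedge with exactly [s] vertices off [L] when shrinking. *)
have hL h : h \in H -> s.+1 <= #|h :\: L|.
  move=> /Hr/eqP; rewrite -(cardsID L h).
  by have := subset_leq_card (subsetIr h L); lia.
have [le|[A [AL cA bA]]] := low_degree_stars l0 (ls : l < s.+1) hL LP c.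
  by right; rewrite card_ord in le.
left; pose H1 := [set h in H | [disjoint h & A]].
have H1H : H1 \subset H by apply/subsetP=> h; rewrite inE => /andP[].
case: (@tree_bound _ _ Tc n H1 L s) => //.
- by move=> h /(subsetP H1H)/hL/ltnW.
- by move=> h h' /(subsetP H1H)/hL + _ E; rewrite E ltnn.
- move=> le; rewrite (card_filter_disjoint H A) leq_add //.
  apply: leq_trans (_ : #|A| * D <= _); last by rewrite leq_mul2r cA orbT.
  by apply: card_meet => x /(subsetP AL); rewrite inE; apply: LP.
(* The copy of [T] uses hyperedges missing [A] and the stars those meeting it, so both hyperedges
   and cores are disjoint. *)
move=> bT; exfalso; apply: (noF _ _ _ _ _ _ _ _ bT (berge_in_meet bA)) => //.
- apply/pred0P=> h /=; rewrite !inE.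
  by case: [disjoint h & A]; rewrite /= ?andbF.
- apply/pred0P=> x /=; apply/andP=> -[]; rewrite inE => /andP[_ /bigcupP[h]].
  by rewrite inE => /andP[_ /disjointFr dh] /dh ->.
by apply/subsetP=> h; rewrite inE => /andP[].
Qed.

(** * The block hypergraph and the lower bound *)

Lemma star_connected l (x y : 'I_l.+1) : connect (adj (star l)) x y.
Proof.
apply: (@connect_trans _ _ ord0).
  by have [->|x0] := eqVneq x ord0; rewrite ?connect0 // connect1 //= /star_adj x0 orbT.
by have [->|y0] := eqVneq y ord0; rewrite ?connect0 // connect1 //= /star_adj eq_sym y0.
Qed.

Lemma card_edges_star l : l <= #|edges (star l)|.
Proof.
rewrite -{1}[l]card_ord -(card_imset (f := fun i : 'I_l => [set ord0; lift ord0 i])).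
  apply/subset_leq_card/subsetP=> _ /imsetP[i _ ->].
  by apply: mem_edges; rewrite /= /star_adj neq_lift.
by move=> i j /set2_eqP[[_ /lift_inj]|[/eqP]] //; rewrite (negPf (neq_lift _ _)).
Qed.

Section BlockConstruction.
Variables (n c N q m : nat) (K : {set 'I_n}) (iota : 'I_N * 'I_q -> 'I_n).
Hypotheses (iotaI : injective iota) (iotaK : forall p, iota p \in ~: K).
Hypotheses (mq : m <= q) (q1 : 1 < q).

(** [p.1] selects the block and [p.2] the omitted vertex, which ranges over only [m] of the [q]
    positions. *)
Definition block_edge (p : 'I_N * 'I_m) : {set 'I_n} :=
  K :|: [set iota (p.1, u) | u in [set~ widen_ord mq p.2]].
Definition block_graph : {set {set 'I_n}} := block_edge @: setT.

Lemma mem_block_edge b u p :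
  (iota (b, u) \in block_edge p) = (b == p.1) && (u != widen_ord mq p.2).
Proof.
have := iotaK (b, u); rewrite !inE => /negPf-> /=.
apply/imsetP/andP=> [[u' + /iotaI[-> ->]]|[/eqP-> uN]]; first by rewrite !inE eqxx.
by exists u; rewrite ?inE.
Qed.

Lemma block_edgeP p x : x \in block_edge p -> x \notin K ->
  exists u, x = iota (p.1, u).
Proof. by rewrite inE => /orP[->//|/imsetP[u _ ->] _]; exists u. Qed.

Lemma card_block_edge p : #|block_edge p| = #|K| + q.-1.
Proof.
rewrite cardsU [_ :&: _](_ : _ = set0) ?cards0 ?subn0.
  by rewrite card_imset ?cardsC1 ?card_ord // => u u' /iotaI[].
apply/setP=> x; rewrite !inE; apply/andP=> -[xK /imsetP[u _ E]].
by have := iotaK (p.1, u); rewrite inE -E xK.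
Qed.

Lemma card_block_graph : #|block_graph| = N * m.
Proof.
rewrite card_imset ?cardsT ?card_prod ?card_ord // => -[b t] [b' t'] E.
(* A vertex kept from the block identifies the block; the missing one then identifies [t]. *)
have [u ut] : exists u, u != widen_ord mq t.
  have : 0 < #|[set~ widen_ord mq t]| by rewrite cardsC1 card_ord; lia.
  by case/card_gt0P=> u; rewrite !inE; exists u.
have := mem_block_edge b u (b, t); rewrite E mem_block_edge /= eqxx ut.
case/andP=> /eqP eb _; subst b'.
have := mem_block_edge b (widen_ord mq t) (b, t); rewrite E mem_block_edge /= !eqxx /=.
by move/negbFE/eqP/(congr1 val)=> /= /val_inj->.
Qed.

(* A connected graph with core off [K] cannot leave a block, and a block
   carries only [m] hyperedges. *)
Lemma block_graph_connected (U : finType) (Z : sgraph U) :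
  (forall x y : U, connect (adj Z) x y) ->
  berge_in Z block_graph (~: K) -> #|edges Z| <= m.
Proof.
move=> Zc [f [g [fI fK gP gI]]].
have [->//|/card_gt0P[_ /edgesP[x0 [y0 [xy0 _]]]]] := posnP #|edges Z|.
have gE x y : adj Z x y -> exists p,
    [/\ g x y = block_edge p, exists u, f x = iota (p.1, u) & exists u, f y = iota (p.1, u)].
  move=> xy; have [/imsetP[p _ E] fx gC] := gP _ _ xy.
  have [_ fy _] := gP _ _ (etrans (adj_sym Z y x) xy).
  exists p; split=> //; apply: block_edgeP; rewrite -?E //; first by have := fK x; rewrite inE.
    by rewrite -gC.
  by have := fK y; rewrite inE.
have [p0 [_ [u0 fx0] _]] := gE _ _ xy0.
(* The vertices sent into the block of [x0]: closed under adjacency, hence all of them by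
   connectivity. *)
pose a := [pred x | [exists u, f x == iota (p0.1, u)]].
have ah x y : adj Z x y -> a x -> a y.
  move=> /gE[p [_ [u fx] [u' fy]]] /existsP[u'' /eqP].
  rewrite fx => /iotaI[E _]; apply/existsP; exists u'; by rewrite fy E.
have acl : closed (adj Z) a.
  by move=> x y xy; apply/idP/idP; apply: ah; rewrite // adj_sym.
have aT x : a x.
  rewrite -[a x](closed_connect acl (Zc x0 x)).
  by apply/existsP; exists u0; rewrite fx0.
have [|phi phiE] := @edge_label _ _ Z g; first by move=> x y /gP[].
have phiI : {in edges Z &, injective phi}.
  move=> _ _ /edgesP[x [y [xy ->]]] /edgesP[x' [y' [xy' ->]]].
  by rewrite !phiE //; apply: gI.
rewrite -(card_in_imset phiI).
apply: leq_trans (_ : #|[set block_edge (p0.1, t) | t : 'I_m]| <= _).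
  apply/subset_leq_card/subsetP=> _ /imsetP[_ /edgesP[x [y [xy ->]]] ->].
  rewrite phiE //; have [[b t] [-> [u fx] _]] := gE _ _ xy.
  have /existsP[u' /eqP] := aT x; rewrite fx => /iotaI[/= -> _].
  exact: imset_f.
by apply: leq_trans (leq_imset_card _ _) _; rewrite card_ord.
Qed.

(* Some component of the forest avoids the [c] vertices of [K]. *)
Lemma block_graph_berge_free (V : finType) (T : sgraph V) l :
  (forall x y : V, connect (adj T) x y) ->
  #|K| <= c -> m < #|edges T| -> m < l ->
  ~~ contains_berge (dunion T (copies c (star l))) block_graph.
Proof.
move=> Tc cK mT ml; apply/negP=> /contains_bergeP[f [g fg]].
have [fI _ _ _] := fg.
(* [None] names the tree and [Some i] the [i]-th star: [c + 1] components, of which at most [c] can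
   meet [K]. *)
pose comp (u : V + 'I_c * 'I_l.+1) := if u is inr p then Some p.1 else None.
have [o no] : exists o, o \notin comp @: (f @^-1: K).
  apply/existsP; apply: contraT => /existsPn all.
  have : #|{: option 'I_c}| <= #|comp @: (f @^-1: K)|.
    by rewrite -cardsT; apply/subset_leq_card/subsetP=> o _; have := all o; rewrite negbK.
  rewrite card_option card_ord leqNgt ltnS => /negP[].
  apply: leq_trans (leq_imset_card _ _) _; rewrite -(card_imset _ fI).
  apply: leq_trans cK; apply/subset_leq_card/subsetP=> _ /imsetP[u + ->].
  by rewrite inE.
have fK u : comp u = o -> f u \in ~: K.
  move=> E; rewrite inE; apply: contra no => fu; rewrite -E imset_f //.
  by rewrite inE.
case: o fK {no} => [i|] fK.
  have : #|edges (star l)| <= m.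
    apply: block_graph_connected; first exact: star_connected.
    apply: (berge_emb_hom (i := fun x => inr (i, x)) _ _ _ fg) => [x y []|x y xy|x] //.
      by rewrite /= /copies_adj /= eqxx.
    exact: fK.
  by have := card_edges_star l; lia.
have : #|edges T| <= m.
  apply: block_graph_connected => //.
  apply: (berge_emb_hom (i := inl) _ _ _ fg) => [x y []|x y xy|x] //.
  exact: fK.
by lia.
Qed.

End BlockConstruction.

Lemma ex_berge_lower (V : finType) (T : sgraph V) c l m q N n :
  (forall x y : V, connect (adj T) x y) ->
  m < #|edges T| -> m < l -> m <= q -> 1 < q -> c + N * q <= n ->
  m * N <= ex_berge (c + q.-1) n (dunion T (copies c (star l))).
Proof.
move=> Tc mT ml mq q1 cN.
have [K _ cK] : exists2 K : {set 'I_n}, K \subset setT & #|K| = c.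
  by apply: subset_of_card; rewrite cardsT card_ord; lia.
have [|i iI iK] := @card_le_injection ('I_N * 'I_q)%type _ (~: K).
  by rewrite card_prod !card_ord cardsCs setCK cK card_ord; lia.
rewrite mulnC -(card_block_graph iI iK mq q1) /ex_berge.
rewrite (bigD1 (block_graph K i mq)) /= ?leq_maxl //.
rewrite block_graph_berge_free ?cK // andbT.
by apply/forall_inP=> _ /imsetP[p _ ->]; rewrite card_block_edge // cK.
Qed.

(** * Both bounds with the parameters of the statement *)

Theorem theorem3p2 (k l1 l2 r : nat) (hk : 2 <= k) (hl1 : 2 <= l1)
    (hl2 : 2 <= l2) (hr : l1 + l2 + k - 1 <= r)
    (V : finType) (T : sgraph V) (hT : is_tree T) (hTe : #|edges T| = l1)
    (hex : forall m : nat,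
      ((ex_berge (r - k + 1) m T)%:R <=
         (m * (l1 - 1))%:R / (r - k + 2)%:R :> rat)%R) :
  (forall n : nat, k - 1 <= n ->
     (minn l1 l2 - 1) * ((n - (k - 1)) %/ (r - k + 2)) <=
       ex_berge r n (dunion T (copies (k - 1) (star l2))))
  /\
  (exists C : rat, exists n0 : nat, forall n : nat, n0 <= n ->
     ((ex_berge r n (dunion T (copies (k - 1) (star l2))))%:R <=
        ((maxn l1 l2 - 1) * n)%:R / (r - k + 2)%:R + C :> rat)%R).
Proof.
have [_ Tc _] := hT; split=> [n kn|].
  have -> : r = (k - 1) + (r - k + 2).-1 by lia.
  by apply: ex_berge_lower => //; lia.
have qE : r - k + 2 = (r - k + 1).+1 by lia.
rewrite qE in hex *; set s := r - k + 1 in hex *.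
have q0 : (0 < (s.+1)%:R :> rat)%R by rewrite ltr0n.
have {}hex n : ex_berge s n T * s.+1 <= n * (l1 - 1).
  by rewrite -(ler_nat rat) natrM -ler_pdivlMr.
(* The error term of [berge_free_bound], which does not depend on [n]. *)
pose C := (k - 1) * l2.+1 * degree_threshold #|V| (k - 1) l2.
exists C%:R%R, 0; move=> n _.
rewrite -lerBlDr ler_pdivlMr // mulrBl lerBlDr -!natrM -natrD ler_nat.
(* With denominators cleared, bounding the maximum reduces to bounding each admissible [H]. *)
elim/big_ind: (ex_berge _ _ _) => [|x y|H /andP[Hr nb]].
- by rewrite mul0n.
- by move=> hx hy; rewrite maxnMl geq_max hx hy.
have rE : r = s + (k - 1) by rewrite /s; lia.
rewrite rE in Hr.
have [|||le|le] := berge_free_bound Tc _ _ _ Hr nb; rewrite ?hTe; try lia.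
  apply: leq_trans (_ : (ex_berge s n T + C) * s.+1 <= _); first by rewrite leq_mul2r le orbT.
  rewrite mulnDl leq_add2r; apply: leq_trans (hex n) _.
  by rewrite mulnC leq_mul2r; apply/orP; right; lia.
apply: leq_trans le _; rewrite leq_add2r leq_mul2r; apply/orP; right; lia.
Qed.
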